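(* Let $X$ be a set, let $m,n\ge 2$ be integers, and let $f\in\Omega_m(X)$ be such that $(X,f)$ is an $m$-ary monoid. The following statements hold. (1) Let $g\in\Omega_n(X)$ be an invertible element in $(\Omega_n(X),\odot_f)$. Then \[\mathrm{Inv}(g,\odot_f)=\{h\in\Omega_n(X)\colon h(\overline a)\in\mathrm{Inv}(g(\overline a),f)\text{ for all }\overline a\in X^n\}.\] (2) Let $c\in X$. If $c^{-1}\in\mathrm{Inv}(c,f)$, then $\gamma_{c^{-1}}\in\mathrm{Inv}(\gamma_c,\odot_f)$. (3) Let $c\in X$. If $(\gamma_c)^{-1}\in\mathrm{Inv}(\gamma_c,\odot_f)$, then $\mathrm{Img}((\gamma_c)^{-1})\subseteq\mathrm{Inv}(c,f)$. (4) If $(X,f)$ has unique inverses, then $(\Omega_n(X),\odot_f)$ also has unique inverses. More precisely, the inverse $g^{-1}$ of $g\in\Omega_n(X)$ is given by $g^{-1}(\overline a)=(g(\overline a))^{-1}$ for all $\overline a\in X^n$. (5) If $(\Omega_n(X),\odot_f)$ has unique inverses, then $(X,f)$ also has unique inverses. (Here $c^{-1}$ and $(\gamma_c)^{-1}$ in (2) and (3) denote arbitrary elements of the indicated sets of inverses.)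
   Context: For a set $Y$, $\Omega_m(Y)$ is the set of all $m$-ary operations $Y^m\to Y$. For $f\in\Omega_m(X)$, the $m$-ary operation $\odot_f$ on the set $\Omega_n(X)$ is defined by $\odot_f(g_1,\ldots,g_m)(\overline a):=f(g_1(\overline a),\ldots,g_m(\overline a))$ for all $g_1,\ldots,g_m\in\Omega_n(X)$ and $\overline a\in X^n$. For $F\in\Omega_m(Y)$, $I(Y,F)$ is the set of identity elements of $(Y,F)$: those $e\in Y$ such that $F(\underbrace{e,\ldots,e}_{i},a,\underbrace{e,\ldots,e}_{m-i-1})=a$ for all $a\in Y$ and all integers $0\le i<m$. The pair $(Y,F)$ is an $m$-ary monoid iff $I(Y,F)\ne\emptyset$ (no associativity is required). In an $m$-ary monoid $(Y,F)$, an element $a\in Y$ is invertible if there exist $a^{-1}\in Y$ and $e\in I(Y,F)$ such that $F(\underbrace{a,\ldots,a}_{i},a^{-1},\underbrace{a,\ldots,a}_{m-i-1})=e$ for every integer $0\le i<m$ (with the same $e$ for all $i$). Such an $a^{-1}$ is an inverse of $a$; $\mathrm{Inv}(a,F)$ is the set of all inverses of $a$ in $(Y,F)$. $(Y,F)$ has unique inverses if $|\mathrm{Inv}(a,F)|=1$ for all $a\in Y$, in which case $a^{-1}$ denotes the unique inverse of $a$. For $g\in\Omega_n(X)$, $\mathrm{Img}(g):=\{g(\overline a)\colon\overline a\in X^n\}$. For $c\in X$, $\gamma_c\in\Omega_n(X)$ is the constant map $\gamma_c(\overline a):=c$. *)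

(* Defs.v *)
From mathcomp Require Import all_boot.
From mathcomp Require Import all_classical.

Set Implicit Arguments.
Unset Strict Implicit.
Unset Printing Implicit Defensive.

Local Open Scope classical_set_scope.
Local Open Scope card_scope.

Definition operation (m : nat) (Y : Type) : Type := m.-tuple Y -> Y.

(* (e, ..., e, a, e, ..., e), with [a] in position [i], preceded by [i] and
   followed by [m - i - 1] copies of [e] *)
Definition insert_at (m : nat) (Y : Type) (i : 'I_m) (e a : Y) : m.-tuple Y :=
  [tuple if j == i then a else e | j < m].

Section Operations.
Variables (m : nat) (Y : Type).
Implicit Types (F : operation m Y) (a : Y).

Definition identities F : set Y :=
  [set e | forall (a : Y) (i : 'I_m), F (insert_at i e a) = a].

(* no associativity is required *)
Definition is_mary_monoid F : Prop := identities F !=set0.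

(* the identity [e] is the same for all positions [i], but may depend on [a]
   and [b], since [F] may have several identities *)
Definition inverses a F : set Y :=
  [set b | exists2 e, identities F e &
             forall i : 'I_m, F (insert_at i a b) = e].

Definition invertible a F : Prop := inverses a F !=set0.

Definition has_unique_inverses F : Prop := forall a, inverses a F #= `I_1.

Lemma unique_inverse_ex F (uF : has_unique_inverses F) a :
  exists b, inverses a F b.
Proof.
have /card_set_bijP[p [_ _ p_surj]] := uF a.
by have [//|b ab _] := p_surj 0%N; exists b.
Qed.

Definition unique_inverse F (uF : has_unique_inverses F) a : Y :=
  sval (cid (unique_inverse_ex uF a)).

End Operations.

Definition odot (m n : nat) (X : Type) (f : operation m X) :
    operation m (operation n X) :=
  fun g a => f [tuple tnth g j a | j < m].
Arguments odot {m} n {X} f.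

Definition Img (n : nat) (X : Type) (g : operation n X) : set X := range g.

Definition const_op (n : nat) (X : Type) (c : X) : operation n X := fun=> c.
Arguments const_op n {X} c.

(* Main.v *)
Require Import Defs.
From mathcomp Require Import all_boot.
From mathcomp Require Import all_classical.

Local Open Scope classical_set_scope.

(** The operation on [operation n X] is computed pointwise, so identities and
    inverses are exactly the pointwise ones: constant operations test whether
    each value of an identity is an identity, and conversely the identities
    witnessing the pointwise inverses are glued by choice. *)

Lemma odot_insert_at (X : Type) (m n : nat) (f : operation m X) (i : 'I_m)
    (e g : operation n X) (a : n.-tuple X) :
  odot n f (insert_at i e g) a = f (insert_at i (e a) (g a)).
Proof.
by congr f; apply: eq_from_tnth => j; rewrite !tnth_mktuple; case: (j == i).
Qed.

Lemma identities_odot (X : Type) (m n : nat) (f : operation m X)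
    (e : operation n X) :
  identities (odot n f) e <-> forall a, identities f (e a).
Proof.
split=> [eid a x i|eid g i].
  (* Any [x] is the value at [a] of [const_op n x], an operation to which the identity law of [e]
     applies. *)
  by rewrite -(odot_insert_at _ _ _ _ _ _ (const_op n x)) eid.
by apply/funext => a; rewrite odot_insert_at eid.
Qed.

Lemma inverses_odot (X : Type) (m n : nat) (f : operation m X)
    (g h : operation n X) :
  inverses g (odot n f) h <-> forall a, inverses (g a) f (h a).
Proof.
split=> [[e /identities_odot eid ghe] a|gh].
  by exists (e a) => // i; rewrite -odot_insert_at ghe.
have /choice[e egh] : forall a, exists e, identities f e /\
    forall i : 'I_m, f (insert_at i (g a) (h a)) = e.
  by move=> a; have [e eid ghe] := gh a; exists e.
exists e; first by apply/identities_odot => a; have [] := egh a.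
by move=> i; apply/funext => a; rewrite odot_insert_at; have [_ ->] := egh a.
Qed.

(** Trades a cardinality for an explicit element, so that uniqueness of inverses can be used by
    rewriting. *)
Lemma card_eq_I1P (T : Type) (A : set T) :
  (A #= `I_1)%card <-> exists x, A = [set x].
Proof.
split=> [/card_set_bijP[p [pI p_inj p_surj]]|[x ->]]; last first.
  exact: card_set1.
have [//|x Ax _] := p_surj 0%N; exists x.
apply/seteqP; split=> [y Ay|_ ->//].
(* Both [p y] and [p x] lie in [I_1], hence are 0. *)
apply: p_inj; rewrite ?inE //.
by move: (pI _ Ay) (pI _ Ax) => /=; case: (p y) => //; case: (p x).
Qed.

(** Frees [unique_inverse] from the choice made by [cid]: in a singleton every choice gives the same
    element. *)
Lemma unique_inverseP (m : nat) (Y : Type) (F : operation m Y)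
    (uF : has_unique_inverses F) (a : Y) :
  inverses a F = [set unique_inverse uF a].
Proof.
rewrite /unique_inverse; case: cid => b /= ab.
by have /card_eq_I1P[x ax] := uF a; move: ab; rewrite ax => ->.
Qed.

Theorem proposition3p6 (X : Type) (m n : nat) (hm : (2 <= m)%N) (hn : (2 <= n)%N)
    (f : operation m X) (hf : is_mary_monoid f) :
  [/\ forall g : operation n X, invertible g (odot n f) ->
        inverses g (odot n f) =
          [set h : operation n X |
             forall a : n.-tuple X, inverses (g a) f (h a)],
      forall c c' : X, inverses c f c' ->
        inverses (const_op n c) (odot n f) (const_op n c'),
      forall (c : X) (h : operation n X),
        inverses (const_op n c) (odot n f) h -> Img h `<=` inverses c f,
      forall uX : has_unique_inverses f,
        exists uO : has_unique_inverses (odot n f),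
          forall (g : operation n X) (a : n.-tuple X),
            unique_inverse uO g a = unique_inverse uX (g a) &
      has_unique_inverses (odot n f) -> has_unique_inverses f].
Proof.
split=> [g _|c c' cc'|c h /inverses_odot ch _ [a _ <-]|uX|uO c].
- by apply/seteqP; split=> h /inverses_odot.
- exact/inverses_odot.
- exact: ch.
(* This one equality yields both the uniqueness of inverses and the pointwise formula. *)
- have inv_g g : inverses g (odot n f) = [set fun a => unique_inverse uX (g a)].
    apply/seteqP; split=> [h /inverses_odot gh|_ ->].
      by apply/funext => a; move: (gh a); rewrite (unique_inverseP _ _ _ uX).
    by apply/inverses_odot => a; rewrite (unique_inverseP _ _ _ uX).
  have uO : has_unique_inverses (odot n f).
    by move=> g; apply/card_eq_I1P; eexists; exact: inv_g.
  exists uO => g a.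
  have : inverses g (odot n f) (unique_inverse uO g).
    by rewrite (unique_inverseP _ _ _ uO).
  by rewrite inv_g => ->.
- have /card_eq_I1P[h inv_h] := uO (const_op n c).
  have ch : inverses (const_op n c) (odot n f) h by rewrite inv_h.
  (* The tuple only supplies a point at which to evaluate [h]; the element [c] at hand provides
     one. *)
  apply/card_eq_I1P; exists (h (nseq_tuple n c)).
  apply/seteqP; split=> [b cb|_ ->]; last exact: (inverses_odot _ _ _ _ _ _).1.
  (* A second inverse [b] of [c] lifts to a constant inverse, which must be [h]; so every value of
     [h] is [b]. *)
  have : inverses (const_op n c) (odot n f) (const_op n b).
    exact/inverses_odot.
  by rewrite inv_h => <-.
Qed.
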